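(* For every $m,n\in\mathbb{N}$, the total number $s(m,n)$ of subgroups of the group $\mathbb{Z}_m\times\mathbb{Z}_n$ is given by $$s(m,n)=\sum_{a\mid m,\ b\mid n}\gcd(a,b)=\sum_{d\mid\gcd(m,n)}\phi(d)\,\tau(m/d)\,\tau(n/d)=\sum_{d\mid\gcd(m,n)}d\,\tau(mn/d^2).$$
   Context: $\mathbb{N}=\{1,2,\ldots\}$. $\mathbb{Z}_m$ denotes the additive group of residue classes modulo $m$. $\tau(n)$ is the number of positive divisors of $n$ and $\phi$ is Euler's totient function. All divisors in the sums are positive. *)

(* Defs.v *)
From mathcomp Require Import all_boot all_fingroup all_algebra.

Set Implicit Arguments.
Unset Strict Implicit.
Unset Printing Implicit Defensive.

(* [Zp m] is used rather than ['Z_m]: the type ['Z_1] has two elements, but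
   [Zp 1] is the trivial subgroup of it, so [Zp m] is cyclic of order m for
   all m > 0.  The group law is addition modulo m. *)
Definition ZxZ (m n : nat) : {group 'Z_m * 'Z_n} := setX_group (Zp_group m) (Zp_group n).

Definition num_subgroups (m n : nat) : nat := #|subgroups (ZxZ m n)|.

Definition tau (n : nat) : nat := size (divisors n).

(* Main.v *)
Require Import Defs.
From mathcomp Require Import all_boot all_fingroup all_algebra.
From mathcomp Require Import all_solvable.

(** The first equality is Goursat's description of the subgroups H of a product
    A x B.  Such an H is determined by its projection P to A, by its kernel
    K = {z in B | (1, z) in H}, and by the homomorphism P -> B / K whose graph
    is the image of H in P x (B / K).  When P is cyclic with generator p,
    a homomorphism P -> B / K is the choice of an image c of p with
    c ^ #|P| = 1 ([card_subgroups_fst_ker]).  When B is cyclic too, there are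
    gcd(#|P|, #|B : K|) such c ([card_Ldiv_cyclic]); a cyclic group has exactly
    one subgroup of each order dividing its own, so summing over P and K gives
    the sum of gcd(a, b) over a | #|A| and b | #|B|
    ([card_subgroups_setX_cyclic]).

    The second equality expands gcd(a, b) as the sum of phi(d) over d | gcd(a, b)
    and exchanges the sums: d divides tau(m / d) of the a's and tau(n / d) of
    the b's ([sum_gcd_totient]).

    The third one rests on the identity
      tau(m) tau(n) = sum of tau(mn / d^2) over d | gcd(m, n)    ([tau_mul]).
    Both sides count by the values of e | mn.  On the left, the pairs (a, b)
    with a | m, b | n and ab = e; there are tau(gcd(m, n, e, mn / e)) of them
    ([count_factorizations]).  On the right, the d | gcd(m, n) such that
    e = dc with c | mn / d^2; these are the d dividing m, n, e and mn / e.
    Applying the identity to m / d and n / d and grouping the terms by a = dc,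
    the sum of phi(d) tau(m / d) tau(n / d) becomes the sum over a | gcd(m, n) of
    tau(mn / a^2) times the sum of phi(d) over d | a, which is a
    ([sum_totient_tau]). *)

Set Implicit Arguments.
Unset Strict Implicit.
Unset Printing Implicit Defensive.

(** * Sums over divisors *)

Lemma big_divisors_between N M d (F : nat -> nat) :
    0 < N -> M %| N -> d %| M ->
  \sum_(e <- divisors N | (d %| e) && (e %| M)) F e =
  \sum_(c <- divisors (M %/ d)) F (d * c).
Proof.
move=> N0 MN dM; have M0 := dvdn_gt0 N0 MN; have d0 := dvdn_gt0 M0 dM.
have q0 : 0 < M %/ d by rewrite divn_gt0 // dvdn_leq.
rewrite -big_filter -(big_map (muln d) predT F); apply: perm_big.
have injd : injective (muln d) by move=> x y /eqP; rewrite eqn_pmul2l // => /eqP.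
apply: uniq_perm; rewrite ?filter_uniq ?(map_inj_uniq injd) ?divisors_uniq //.
move=> e; rewrite mem_filter -dvdn_divisors //.
apply/idP/mapP => [/andP[/andP[/dvdnP[c ->] cdM] _] | [c cq ->]].
  by exists c; rewrite 1?mulnC // -dvdn_divisors // dvdn_divRL.
rewrite -dvdn_divisors // dvdn_divRL // mulnC in cq.
by rewrite dvdn_mulr // cq (dvdn_trans cq).
Qed.

Lemma big_divisors_dvd N M (F : nat -> nat) :
    0 < N -> M %| N ->
  \sum_(e <- divisors N | e %| M) F e = \sum_(e <- divisors M) F e.
Proof.
move=> N0 MN; have := big_divisors_between F N0 MN (dvd1n M).
under eq_bigl do rewrite dvd1n.
by under [RHS]eq_bigr do rewrite mul1n; rewrite divn1.
Qed.

Lemma big_divisors_multiple N d (F : nat -> nat) :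
    0 < N -> d %| N ->
  \sum_(e <- divisors N | d %| e) F e = \sum_(c <- divisors (N %/ d)) F (d * c).
Proof.
move=> N0 dN; rewrite -(@big_divisors_between N) //.
rewrite big_seq_cond [RHS]big_seq_cond; apply: eq_bigl => e.
by rewrite -dvdn_divisors //; case: (e %| N); rewrite ?andbT.
Qed.

Lemma sum_divisors_compl n (F : nat -> nat) : 0 < n ->
  \sum_(d <- divisors n) F (n %/ d) = \sum_(d <- divisors n) F d.
Proof.
move=> n0; rewrite -(big_map (divn n) predT F); apply: perm_big.
have divK d : d %| n -> n %/ (n %/ d) = d.
  by move=> dn; rewrite divnA // mulKn.
apply: uniq_perm; rewrite ?divisors_uniq //.
  rewrite map_inj_in_uniq ?divisors_uniq // => d e.
  by rewrite -!dvdn_divisors // => /divK {2}<- /divK {2}<- ->.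
move=> d; apply/mapP/idP => [[e]|]; rewrite -!dvdn_divisors //.
  by move=> en ->; rewrite dvdn_div.
by move=> dn; exists (n %/ d); rewrite ?divK // -dvdn_divisors // dvdn_div.
Qed.

(** * Arithmetic identities *)

Lemma tau_sum n : tau n = \sum_(c <- divisors n) 1.
Proof. by rewrite sum1_size. Qed.

(** Grouping the pairs d | a | N by d, with a = d c. *)
Lemma exchange_divisors N (F : nat -> nat -> nat) : 0 < N ->
  \sum_(a <- divisors N) \sum_(d <- divisors a) F a d =
  \sum_(d <- divisors N) \sum_(c <- divisors (N %/ d)) F (d * c) d.
Proof.
move=> N0.
transitivity (\sum_(a <- divisors N) \sum_(d <- divisors N | d %| a) F a d).
  apply: eq_big_seq => a; rewrite -dvdn_divisors // => aN.
  by rewrite big_divisors_dvd.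
rewrite (exchange_big_dep predT) //=; apply: eq_big_seq => d.
by rewrite -dvdn_divisors // => dN; rewrite big_divisors_multiple.
Qed.

Lemma sum_totient_divisors n : 0 < n -> \sum_(d <- divisors n) totient d = n.
Proof.
move=> n0; rewrite -[RHS]sum_totient_dvd.
rewrite -(big_mkord (fun d => d %| n) totient) -[RHS]big_filter.
apply: perm_big; apply: uniq_perm; rewrite ?filter_uniq ?iota_uniq ?divisors_uniq //.
move=> d; rewrite mem_filter mem_index_iota -dvdn_divisors // ltnS.
by case dn: (d %| n) => //=; rewrite dvdn_leq.
Qed.

Lemma sum_gcd_totient m n : 0 < m -> 0 < n ->
  \sum_(a <- divisors m) \sum_(b <- divisors n) gcdn a b =
  \sum_(d <- divisors (gcdn m n)) totient d * tau (m %/ d) * tau (n %/ d).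
Proof.
move=> m0 n0; have g0 : 0 < gcdn m n by rewrite gcdn_gt0 m0.
transitivity (\sum_(a <- divisors m) \sum_(b <- divisors n)
    \sum_(d <- divisors (gcdn m n) | (d %| a) && (d %| b)) totient d).
  apply: eq_big_seq => a; rewrite -dvdn_divisors // => am.
  apply: eq_big_seq => b; rewrite -dvdn_divisors // => bn.
  under eq_bigl do rewrite -dvdn_gcd.
  rewrite big_divisors_dvd ?sum_totient_divisors //.
    by rewrite gcdn_gt0 (dvdn_gt0 m0 am).
  by rewrite dvdn_gcd (dvdn_trans (dvdn_gcdl _ _) am) (dvdn_trans (dvdn_gcdr _ _) bn).
under eq_bigr do rewrite (exchange_big_dep predT) //=.
rewrite exchange_big; apply: eq_big_seq => d.
rewrite -dvdn_divisors // dvdn_gcd => /andP[dm dn].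
(* For a fixed d, the sum over b is zero unless d %| a. *)
transitivity (\sum_(a <- divisors m | d %| a) totient d * tau (n %/ d)).
  rewrite [RHS]big_mkcond; apply: eq_bigr => a _.
  case: (d %| a); last by rewrite big_pred0.
  rewrite big_divisors_multiple // tau_sum big_distrr /=.
  by apply: eq_bigr => c _; rewrite [RHS]muln1.
rewrite big_divisors_multiple // [tau (m %/ d)]tau_sum big_distrr big_distrl /=.
by apply: eq_bigr => c _; rewrite [_ * 1]muln1.
Qed.

(** The a's counted are those for which e = a b with a | m and b | n. *)
Lemma count_factorizations m n e : 0 < m -> 0 < n -> e %| m * n ->
  \sum_(a <- divisors m | (a %| e) && (e %| a * n)) 1 =
  tau (gcdn (gcdn m n) (gcdn e (m * n %/ e))).
Proof.
move=> m0 n0 emn; have e0 : 0 < e by apply: dvdn_gt0 emn; rewrite muln_gt0 m0.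
have g0 : 0 < gcdn e n by rewrite gcdn_gt0 e0.
(* Since e always divides a e, e %| a n means e %| a gcd(e, n),
   that is, e / gcd(e, n) %| a. *)
transitivity (\sum_(a <- divisors m | (e %/ gcdn e n %| a) && (a %| gcdn m e)) 1).
  rewrite big_seq_cond [RHS]big_seq_cond; apply: eq_bigl => a.
  rewrite -dvdn_divisors // dvdn_gcd dvdn_divLR ?dvdn_gcdl // muln_gcdr dvdn_gcd.
  rewrite (dvdn_mull a (dvdnn e)) /=; case: (a %| m) => //=; exact: andbC.
have dM : e %/ gcdn e n %| gcdn m e.
  rewrite dvdn_gcd dvdn_divLR ?dvdn_gcdl // muln_gcdr dvdn_gcd emn.
  by rewrite dvdn_mull // dvdn_div // dvdn_gcdl.
rewrite big_divisors_between ?dvdn_gcdl // -tau_sum; congr tau.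
rewrite divnA ?dvdn_gcdl //.
apply/eqP; rewrite -(eqn_pmul2r e0) divnK; last by rewrite -dvdn_divLR ?dvdn_gcdl.
(* Both sides are the gcd of m n, m e, e n and e e. *)
have E d : (d %| gcdn m e * gcdn e n) =
            (d %| gcdn (gcdn m n) (gcdn e (m * n %/ e)) * e).
  rewrite !muln_gcdl !muln_gcdr divnK // !dvdn_gcd [n * e]mulnC.
  by do 4!case: (d %| _).
by rewrite eqn_dvd -E dvdnn E dvdnn.
Qed.

(** The product formula for tau, valid without any coprimality assumption. *)
Lemma tau_mul m n : 0 < m -> 0 < n ->
  tau m * tau n = \sum_(d <- divisors (gcdn m n)) tau ((m * n) %/ d ^ 2).
Proof.
move=> m0 n0; have mn0 : 0 < m * n by rewrite muln_gt0 m0.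
have g0 : 0 < gcdn m n by rewrite gcdn_gt0 m0.
transitivity (\sum_(e <- divisors (m * n)) tau (gcdn (gcdn m n) (gcdn e (m * n %/ e)))).
  rewrite [tau m]tau_sum big_distrl /=.
  (* For a fixed a, each b | n corresponds to e = a b. *)
  transitivity (\sum_(a <- divisors m)
      \sum_(e <- divisors (m * n) | (a %| e) && (e %| a * n)) 1).
    apply: eq_big_seq => a; rewrite -dvdn_divisors // => am.
    have a0 := dvdn_gt0 m0 am.
    by rewrite big_divisors_between ?dvdn_mul ?dvdn_mulr // mulKn // -tau_sum mul1n.
  rewrite (exchange_big_dep predT) //=; apply: eq_big_seq => e.
  by rewrite -dvdn_divisors // => /count_factorizations ->.
(* For a fixed d | gcd(m, n), the e's are the d c with c %| m n / d ^ 2. *)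
transitivity (\sum_(e <- divisors (m * n))
   \sum_(d <- divisors (gcdn m n) | (d %| e) && (e %| m * n %/ d)) 1).
  apply: eq_big_seq => e; rewrite -dvdn_divisors // => emn.
  rewrite tau_sum -(@big_divisors_dvd (gcdn m n)) ?dvdn_gcdl //.
  rewrite big_seq_cond [RHS]big_seq_cond; apply: eq_bigl => d.
  rewrite -dvdn_divisors //; case dg : (d %| gcdn m n) => //=.
  have dmn : d %| m * n by rewrite dvdn_mulr // (dvdn_trans dg) ?dvdn_gcdl.
  by rewrite !dvdn_gcd -dvdn_gcd dg /= !dvdn_divRL // mulnC.
rewrite (exchange_big_dep predT) //=; apply: eq_big_seq => d.
rewrite -dvdn_divisors // dvdn_gcd => /andP[dm dn].
have dmn : d * d %| m * n by rewrite dvdn_mul.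
rewrite big_divisors_between //; first by rewrite -tau_sum -divnMA.
  by rewrite dvdn_div // dvdn_mulr.
by rewrite dvdn_divRL // dvdn_mulr.
Qed.

Lemma sum_totient_tau m n : 0 < m -> 0 < n ->
  \sum_(d <- divisors (gcdn m n)) totient d * tau (m %/ d) * tau (n %/ d) =
  \sum_(d <- divisors (gcdn m n)) d * tau ((m * n) %/ d ^ 2).
Proof.
move=> m0 n0; have g0 : 0 < gcdn m n by rewrite gcdn_gt0 m0.
transitivity (\sum_(a <- divisors (gcdn m n)) \sum_(d <- divisors a)
    totient d * tau (m * n %/ a ^ 2)); last first.
  apply: eq_big_seq => a; rewrite -dvdn_divisors // => ag.
  by rewrite -big_distrl sum_totient_divisors // (dvdn_gt0 g0 ag).
rewrite (exchange_divisors (fun a d => totient d * tau (m * n %/ a ^ 2)) g0).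
apply: eq_big_seq => d; rewrite -dvdn_divisors // => dg.
have d0 := dvdn_gt0 g0 dg.
have [dm dn] : d %| m /\ d %| n by apply/andP; rewrite -dvdn_gcd.
rewrite -mulnA tau_mul ?divn_gt0 // 1?dvdn_leq // big_distrr /=.
have -> : gcdn (m %/ d) (n %/ d) = gcdn m n %/ d.
  by apply/eqP; rewrite -(eqn_pmul2r d0) muln_gcdl !divnK.
apply: eq_bigr => c _; congr (_ * tau _).
rewrite expnMn divnMA; congr (_ %/ _).
by rewrite divn_mulAC // muln_divA // -divnMA.
Qed.

(** * Subgroups of cyclic groups *)

(** The solutions of x ^ n = 1 form the subgroup of order gcd(n, #|C|). *)
Lemma card_Ldiv_cyclic (gT : finGroupType) (C : {group gT}) n :
  cyclic C -> #|'Ldiv_n(C)%g| = gcdn n #|C|.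
Proof.
move=> cycC; have dC : gcdn n #|C| %| #|C| := dvdn_gcdr _ _.
case/cyclicP: (cycC) => x Cx.
have := @cycle_sub_group _ x (gcdn n #|C|); rewrite orderE -Cx => /(_ dC).
(* D is the unique subgroup of C whose order is this gcd. *)
set D := (<[_]>)%G => /setP/(_ D); rewrite !inE eqxx => /andP[sDC /eqP cD].
rewrite -cD; apply: eq_card => y; rewrite !inE -order_dvdn.
apply/andP/idP => [[Cy yn]|Dy].
  have syC : <[y]>%g \subset C by rewrite cycle_subG.
  by rewrite -cycle_subG -(cardSg_cyclic cycC syC sDC) cD dvdn_gcd yn order_dvdG.
split; first exact: (subsetP sDC).
by apply: (@dvdn_trans #|D|); rewrite ?order_dvdG // cD dvdn_gcdl.
Qed.

Lemma sum_subgroups_cyclic (gT : finGroupType) (C : {group gT}) (F : nat -> nat) :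
  cyclic C ->
  \sum_(H in subgroups C) F #|H| = \sum_(d <- divisors #|C|) F d.
Proof.
move=> cycC.
rewrite -big_enum -(big_map (fun H : {group gT} => #|H|) predT F).
apply: perm_big; apply: uniq_perm; rewrite ?divisors_uniq //.
  rewrite map_inj_in_uniq ?enum_uniq // => H K.
  rewrite !mem_enum !inE => sHC sKC /eqP.
  by rewrite -(eq_subG_cyclic cycC) // => /eqP/val_inj.
move=> d; rewrite -dvdn_divisors //; apply/mapP/idP => [[H]|dC].
  by rewrite mem_enum inE => sHC ->; rewrite cardSg.
case/cyclicP: (cycC) => x Cx.
have := @cycle_sub_group _ x d; rewrite orderE -Cx => /(_ dC).
set D := (<[_]>)%G => /setP/(_ D); rewrite !inE eqxx => /andP[sDC /eqP cD].
by exists D; rewrite ?mem_enum ?inE.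
Qed.

(** * Subgroups of a product: Goursat's lemma with a cyclic projection *)

(** The preimage of H under z |-> (1, z) is the Goursat kernel of H. *)
Lemma mem_morphpre_pair1g (gT rT : finGroupType) (H : {set gT * rT}) z :
  (z \in @pair1g gT rT @*^-1 H)%g = ((1%g, z) \in H).
Proof. by rewrite !inE. Qed.

Lemma pairX (gT sT : finGroupType) (x : gT) (y : sT) i :
  ((x, y) ^+ i = (x ^+ i, y ^+ i))%g.
Proof. by elim: i => // i IHi; rewrite !expgS IHi. Qed.

Section Goursat.

Variables (gT rT : finGroupType) (A : {group gT}) (B K : {group rT}).
Hypothesis nKB : (B \subset 'N(K))%g.

(** The map id x (coset K), seen as a morphism on A x B. *)
Definition pair_coset (x : gT * rT) : gT * coset_of K := (x.1, coset K x.2).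

Lemma pair_cosetM : {in setX A B &, {morph pair_coset : x y / (x * y)%g}}.
Proof.
move=> [a b] [a' b'] /setXP[_ Bb] /setXP[_ Bb']; rewrite /pair_coset /=.
by rewrite morphM ?(subsetP nKB).
Qed.

Canonical pair_coset_morphism := Morphism pair_cosetM.

(** For p in A and c in B / K with c ^ #[p] = 1, the subgroup of A x B attached
    to the homomorphism <[p]> -> B / K sending p to c: the preimage under
    [pair_coset] of its graph <[(p, c)]>.  The condition on c is not part of
    the definition; it makes K the kernel ([ker_graph_subgroup]). *)
Definition graph_subgroup p (c : coset_of K) : {group gT * rT} :=
  (pair_coset_morphism @*^-1 <[(p, c)]>)%G.

Lemma graph_subgroupP p c q z : p \in A ->
  reflect (z \in B /\ exists2 i, q = (p ^+ i)%g & coset K z = (c ^+ i)%g)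
          ((q, z) \in graph_subgroup p c).
Proof.
move=> Ap; rewrite inE.
apply: (iffP andP) => [[/setXP[_ Bz]] | [Bz [i -> cz]]].
  by rewrite inE => /cycleP[i]; rewrite pairX => -[-> ->]; split=> //; exists i.
split; first by rewrite inE /= groupX.
by rewrite inE -[X in X \in _]/(p ^+ i, coset K z)%g cz -pairX mem_cycle.
Qed.

Lemma fst_graph_subgroup p c : p \in A -> c \in (B / K)%g ->
  (fst @* graph_subgroup p c = <[p]>)%g.
Proof.
move=> Ap /morphimP[y Ny By ->].
apply/setP => q; apply/morphimP/cycleP => [[[q' z] _ Sqz ->]|[i ->]].
  by have [_ [i -> _]] := graph_subgroupP _ _ _ Ap Sqz; exists i.
exists ((p ^+ i)%g, (y ^+ i)%g); rewrite ?in_setT //.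
by apply/graph_subgroupP => //; split; [exact: groupX | exists i; rewrite ?morphX].
Qed.

Lemma ker_graph_subgroup p c : K \subset B -> p \in A -> (c ^+ #[p] = 1)%g ->
  (@pair1g gT rT @*^-1 graph_subgroup p c = K)%g.
Proof.
move=> sKB Ap cp; apply/setP => z; rewrite mem_morphpre_pair1g.
apply/graph_subgroupP/idP => // [[Bz [i pi zi]]|Kz].
  rewrite coset_idr ?(subsetP nKB) // zi.
  have /dvdnP[j ->] : #[p]%g %| i by rewrite order_dvdn -pi.
  by rewrite mulnC expgM cp expg1n.
by split; [exact: (subsetP sKB)|exists 0; rewrite ?coset_id].
Qed.

Lemma graph_subgroup_inj p : p \in A ->
  {in 'Ldiv_#[p](B / K)%g &, injective (graph_subgroup p)}.
Proof.
move=> Ap c c' /LdivP[/morphimP[y Ny By cy] cp] /LdivP[_ c'p] eqS.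
have : (p, y) \in graph_subgroup p c.
  by apply/graph_subgroupP => //; split=> //; exists 1.
rewrite eqS => /graph_subgroupP[]// _ [i pi]; rewrite -cy => ->.
have : (p ^+ i == p ^+ 1)%g by rewrite -pi.
rewrite eq_expg_mod_order => /eqP ei.
by rewrite -(expg_mod i c'p) ei expg_mod.
Qed.

(** The element c is the coset {y | (p, y) in H} of K. *)
Lemma graph_subgroup_onto p (H : {group gT * rT}) :
    H \subset setX A B -> (fst @* H = <[p]>)%g -> (@pair1g gT rT @*^-1 H = K)%g ->
  exists2 c, c \in 'Ldiv_#[p](B / K)%g & H = graph_subgroup p c.
Proof.
move=> /subsetP sHG fH kH.
have memK z : (z \in K) = ((1%g, z) \in H) by rewrite -kH mem_morphpre_pair1g.
have /morphimP[[p' y] _ Hpy /= pp'] : p \in (fst @* H)%g by rewrite fH cycle_id.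
rewrite -{p'}pp' in Hpy.
have /setXP[Ap By] := sHG _ Hpy; rewrite /= in Ap By.
have Ny := subsetP nKB _ By.
exists (coset K y).
  apply/LdivP; rewrite mem_quotient //; split=> //.
  by rewrite -morphX //= coset_id // memK -(expg_order p) -pairX groupX.
apply/val_inj/setP => -[q z] /=.
apply/idP/graph_subgroupP => // [Hqz | [Bz [i -> cz]]].
  have /setXP[/= _ Bz] := sHG _ Hqz; split=> //.
  have : q \in (fst @* H)%g by apply/morphimP; exists (q, z); rewrite ?inE.
  rewrite fH => /cycleP[i qi]; exists i => //.
  have Kz : (y ^- i * z)%g \in K.
    rewrite memK; have -> : (1, y ^- i * z)%g = ((p, y) ^- i * (q, z))%g.
      by rewrite pairX qi; congr pair; rewrite /= mulVg.
    by rewrite groupM // groupV groupX.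
  have := coset_id Kz; rewrite morphM ?morphV ?groupV ?groupX ?(subsetP nKB) //.
  by rewrite morphX // => /eqP; rewrite -eq_mulVg1 => /eqP.
have Kz : (y ^- i * z)%g \in K.
  rewrite coset_idr ?groupM ?groupV ?groupX ?(subsetP nKB) //.
  by rewrite morphM ?morphV ?groupV ?groupX ?(subsetP nKB) // morphX //= cz mulVg.
have -> : (p ^+ i, z)%g = ((p, y) ^+ i * (1, y ^- i * z))%g.
  by rewrite pairX; congr pair; rewrite /= ?mulg1 ?mulKVg.
by rewrite groupM ?groupX // -memK.
Qed.

End Goursat.

(** The subgroups with projection P and kernel K are counted by the images
    in B / K of a generator of P. *)
Lemma card_subgroups_fst_ker (gT rT : finGroupType) (A P : {group gT})
    (B K : {group rT}) :
    cyclic P -> P \subset A -> (K <| B)%g ->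
  #|[set H in subgroups (setX A B) |
      (fst @* H == P)%g && (@pair1g gT rT @*^-1 H == K)%g]|
  = #|'Ldiv_#|P|(B / K)%g|.
Proof.
move=> /cyclicP[p Pp] sPA /andP[sKB nKB].
have Ap : p \in A by rewrite (subsetP sPA) // Pp cycle_id.
rewrite Pp -orderE -(card_in_imset (@graph_subgroup_inj _ _ _ _ _ nKB _ Ap)).
congr #|pred_of_set _|; apply/setP => H; rewrite !inE.
apply/and3P/imsetP => [[sH /eqP fH /eqP kH]|[c /LdivP[Bc cp] ->]].
  by case: (graph_subgroup_onto nKB sH fH kH) => c; exists c.
by rewrite fst_graph_subgroup // ker_graph_subgroup // subsetIl.
Qed.

Lemma card_subgroups_setX (gT rT : finGroupType) (A : {group gT}) (B : {group rT}) :
    cyclic A -> abelian B ->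
  #|subgroups (setX A B)| =
  \sum_(P in subgroups A) \sum_(K in subgroups B) #|'Ldiv_#|P|(B / K)%g|.
Proof.
move=> cycA cBB; rewrite -sum1_card.
rewrite (partition_big (fun H : {group gT * rT} => [group of fst @* H]%g)
           [in subgroups A]) /=; last first.
  move=> H; rewrite !inE => /subsetP sH; apply/subsetP.
  move=> _ /morphimP[[x z] _ /sH Hx ->].
  by case/setXP: Hx.
apply: eq_bigr => P; rewrite inE => sPA.
rewrite (partition_big (fun H : {group gT * rT} =>
             [group of @pair1g gT rT @*^-1 H]%g)
           [in subgroups B]) /=; last first.
  move=> H; rewrite !inE => /andP[/subsetP sH _]; apply/subsetP => z.
  by rewrite !inE => /sH /setXP[].
apply: eq_bigr => K; rewrite inE => sKB.
rewrite -(@card_subgroups_fst_ker _ _ A) ?(cyclicS sPA) //; last first.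
  by rewrite -sub_abelian_normal.
rewrite -sum1_card; apply: eq_bigl => H.
by rewrite inE -andbA.
Qed.

Lemma card_subgroups_setX_cyclic (gT rT : finGroupType)
    (A : {group gT}) (B : {group rT}) : cyclic A -> cyclic B ->
  #|subgroups (setX A B)| =
  \sum_(a <- divisors #|A|) \sum_(b <- divisors #|B|) gcdn a b.
Proof.
move=> cycA cycB; rewrite card_subgroups_setX ?cyclic_abelian //.
rewrite -(sum_subgroups_cyclic (fun a => \sum_(b <- divisors #|B|) gcdn a b)) //.
apply: eq_bigr => P _.
transitivity (\sum_(K in subgroups B) gcdn #|P| (#|B| %/ #|K|)).
  apply: eq_bigr => K; rewrite inE => sKB.
  rewrite card_Ldiv_cyclic ?quotient_cyclic // card_quotient ?divgS //.
  by rewrite normal_norm -?sub_abelian_normal ?cyclic_abelian.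
rewrite (sum_subgroups_cyclic (fun k => gcdn #|P| (#|B| %/ k))) //.
exact: sum_divisors_compl.
Qed.

(** This includes m <= 1, where Zp m is trivial although 'Z_m has two elements. *)
Lemma cyclic_Zp m : cyclic (Zp m).
Proof.
rewrite /Zp; case: (1 < m); last exact: cyclic1.
by rewrite Zp_cycle cycle_cyclic.
Qed.

Theorem theorem3 (m n : nat) (hm : 0 < m) (hn : 0 < n) :
  [/\ num_subgroups m n = \sum_(a <- divisors m) \sum_(b <- divisors n) gcdn a b,
      \sum_(a <- divisors m) \sum_(b <- divisors n) gcdn a b
        = \sum_(d <- divisors (gcdn m n)) totient d * tau (m %/ d) * tau (n %/ d)
    & \sum_(d <- divisors (gcdn m n)) totient d * tau (m %/ d) * tau (n %/ d)
        = \sum_(d <- divisors (gcdn m n)) d * tau ((m * n) %/ d ^ 2)].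
Proof.
split; [|exact: sum_gcd_totient|exact: sum_totient_tau].
by rewrite /num_subgroups card_subgroups_setX_cyclic ?cyclic_Zp //= !card_Zp.
Qed.
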